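(* Let $n\ge 1$ and define $$\alpha_{n+1}=\frac{1}{2^{m+1}+2^m-2}\quad\text{if } n=2m,\qquad \alpha_{n+1}=\frac{1}{2\cdot 2^{m+1}-2}\quad\text{if } n=2m+1 .$$ Then, for every realization of the item locations $0<u_1<\cdots<u_n<1$ on the circle of length $1$, the minimal travel time $T_n$ satisfies $T_n\le 1-\alpha_{n+1}$. Moreover this upper bound is tight: for every $n\geq 1$ there is a configuration of item locations for which $T_n=1-\alpha_{n+1}$.
   Context: A circle of length $1$ is identified with $[0,1)$. A picker starts at point $0$ and must visit (collect) all $n$ items, located at points $0<u_1<u_2<\cdots<u_n<1$, by moving along the circle at unit speed in either direction; the picker may change direction and need not return to the starting point. $T_n$ denotes the minimal travel time needed to collect all $n$ items. Put $u_0=0$, $u_{n+1}=1$ and $d_i=u_i-u_{i-1}$ for $1\le i\le n+1$. An optimal route changes direction at most once, and the minimal travel time is given by $$T_n=1-\max\Big\{\max_{1\le j\le n}\{d_j-u_{j-1}\},\ \max_{1\le j\le n}\{d_{n+2-j}-(1-u_{n+2-j})\}\Big\}.$$ *)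

(* Defs.v *)
From HB Require Import structures.
From mathcomp Require Import all_boot all_order all_algebra.
From mathcomp Require Import all_classical all_reals.

Set Implicit Arguments.
Unset Strict Implicit.
Unset Printing Implicit Defensive.

Import Order.TTheory GRing.Theory Num.Theory.
Local Open Scope classical_set_scope.
Local Open Scope ring_scope.

(* The circle is R/Z.  Items are indexed from 0: [u i] is the paper's
   u_(i+1). *)
Definition item_locations (R : realType) (n : nat) (u : 'I_n -> R) : Prop :=
  (forall i, 0 < u i < 1) /\ (forall i j : 'I_n, (i < j)%N -> u i < u j).

(* A route is given by its successive legs, each a signed displacement
   travelled at unit speed: a leg [s] lasts [`|s|] and is counterclockwise
   when [0 < s], clockwise when [s < 0].  Any finite number of changes of
   direction is allowed, and so is going around the circle several times. *)
Definition route (R : realType) : Type := seq R.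

Definition duration (R : realType) (r : route R) : R := \sum_(s <- r) `|s|.

(* Positions are lifted to the universal cover R of the circle; [passes x r q]
   says that the lifted route [r] starting at [x] goes through [q]. *)
Fixpoint passes (R : realType) (x : R) (r : route R) (q : R) : Prop :=
  match r with
  | [::] => q = x
  | s :: r' => Num.min x (x + s) <= q <= Num.max x (x + s)
               \/ passes (x + s) r' q
  end.

Definition collects (R : realType) (n : nat) (u : 'I_n -> R) (r : route R) :
    Prop :=
  forall i, exists2 q : R, passes 0 r q & q - u i \is a Num.int.

Definition travel_times (R : realType) (n : nat) (u : 'I_n -> R) : set R :=
  [set duration r | r in [set r | collects u r]].

(* [T] is the minimum, not only the infimum, of the travel times. *)
Definition minimal_travel_time (R : realType) (n : nat) (u : 'I_n -> R)
    (T : R) : Prop :=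
  travel_times u T /\ lbound (travel_times u) T.

(* [alphaS R n] is alpha_(n+1). *)
Definition alphaS (R : realType) (n : nat) : R :=
  let m := n./2 in
  if odd n then 1 / (2 * 2 ^+ m.+1 - 2) else 1 / (2 ^+ m.+1 + 2 ^+ m - 2).

(* Main.v *)
(** A lifted route from 0 covers an interval [[-a, b]] and lasts at least
    [a + b + min a b]; if [u_j] is the last item with [u_j <= b], then
    [1 - u_(j+1) <= a].  So [T_n] is the minimum of the [n+1] numbers
    [1 - (d_(j+1) - min u_j (1 - u_(j+1)))].  If [T_n = 1 - c], then
    [u_(j+1) <= 2 u_j + c], hence [u_j <= (2^j - 1) c], and symmetrically
    [1 - u_(n+1-j) <= (2^j - 1) c]; adding the two bounds at the middle gap
    gives [c >= alpha_(n+1)].  Equality holds when the gaps [d_(j+1)] are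
    proportional to [2 ^ min j (n - j)]. *)
Require Import Defs.
From HB Require Import structures.
From mathcomp Require Import all_boot all_order all_algebra.
From mathcomp Require Import all_classical all_reals.
From mathcomp Require Import zify ring lra.

Set Implicit Arguments.
Unset Strict Implicit.
Unset Printing Implicit Defensive.

Import Order.TTheory GRing.Theory Num.Theory.
Local Open Scope ring_scope.

Lemma duration_cons (R : realType) (s : R) (r : route R) :
  duration (s :: r) = `|s| + duration r.
Proof. by rewrite /duration big_cons. Qed.

(** The arm towards the end reached first is travelled twice, hence the [Num.min]. By induction:
    stretching the hull of the tail, which starts at [x + s], just enough to contain [x] raises the
    left-hand side by at most [|s|]. *)
Lemma route_hull (R : realType) (r : route R) (x : R) :
  exists lo hi : R,
    [/\ lo <= x <= hi,
        hi - lo + Num.min (x - lo) (hi - x) <= duration r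
      & forall q, passes x r q -> lo <= q <= hi].
Proof.
elim: r x => [|s r IH] x.
  exists x, x; split; rewrite ?lexx //.
    by rewrite /duration big_nil subrr minxx addr0.
  by move=> q /= ->; rewrite lexx.
have [lo [hi [/andP[h1 h2] h3 h4]]] := IH (x + s).
exists (Num.min x lo), (Num.max x hi); split.
- by rewrite ge_min le_max lexx.
- rewrite duration_cons; move: h3.
  have s1 := ler_norm s; have s2 := ler_norm (- s); rewrite normrN in s2.
  by case: (leP x lo) => ?; case: (leP x hi) => ?;
    case: (leP (x + s - lo)) => ?; case: (leP (x - _)) => ?; lra.
- move=> q /= [|/h4 /andP[h5 h6]]; last by rewrite ge_min le_max h5 h6 !orbT.
  by move=> /andP[]; case: (leP x lo) => ?;
    case: (leP x hi) => ?; case: (leP x (x + s)) => ?; lra.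
Qed.

Section Locations.
Variables (R : realType) (n : nat) (u : 'I_n -> R).

(* The paper's u_0 = 0, u_1, ..., u_n, u_(n+1) = 1. *)
Definition location (k : nat) : R :=
  if k is k'.+1 then oapp u 1 (insub k') else 0.

Lemma locationS (i : 'I_n) : location i.+1 = u i.
Proof. by rewrite /= valK. Qed.

Lemma location_last : location n.+1 = 1.
Proof. by rewrite /= insubF // ltnn. Qed.

(** Cost of leaving only gap [j] uncrossed: the first [j] items are collected counterclockwise, the
    others clockwise. *)
Definition split_cost (j : nat) : R :=
  let b := location j in let a := 1 - location j.+1 in
  a + b + Num.min a b.

Lemma split_cost_gap (j : nat) :
  split_cost j = 1 - (location j.+1 - location j -
                      Num.min (1 - location j.+1) (location j)).
Proof. by rewrite /split_cost; set x := Num.min _ _; ring. Qed.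

(** Visit the nearer end first; the second leg then sweeps the whole interval. *)
Lemma two_leg_route (a b : R) : 0 <= a -> 0 <= b ->
  exists2 r : route R, duration r = a + b + Num.min a b
    & forall q, - a <= q <= b -> passes 0 r q.
Proof.
move=> a0 b0; have [ab|ba] := leP a b.
  exists [:: - a; a + b].
    rewrite !duration_cons /duration big_nil normrN !ger0_norm //; lra.
  move=> q /andP[q1 q2] /=; right; left.
  by rewrite ge_min le_max; apply/andP; split; apply/orP; [left|right]; lra.
exists [:: b; - (a + b)].
  rewrite !duration_cons /duration big_nil normrN !ger0_norm //; lra.
move=> q /andP[q1 q2] /=; right; left.
by rewrite ge_min le_max; apply/andP; split; apply/orP; [right|left]; lra.
Qed.

Hypothesis hu : item_locations u.

Lemma location_lt (k : nat) : (k <= n)%N -> location k < location k.+1.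
Proof.
case: hu => h1 h2 kn; have [kn'|kn'] := ltnP k n.
  rewrite (locationS (Ordinal kn')); case: k kn kn' => [|k] kn kn'.
    by case/andP: (h1 (Ordinal kn')).
  by rewrite (locationS (Ordinal kn)); apply: h2 => /=.
have -> : location k.+1 = 1 by rewrite -location_last; congr location; lia.
case: k kn kn' => [|k] kn _; first exact: ltr01.
by rewrite (locationS (Ordinal kn)); case/andP: (h1 (Ordinal kn)).
Qed.

Lemma location_le (j k : nat) :
  (j <= k)%N -> (k <= n.+1)%N -> location j <= location k.
Proof.
elim: k => [|k IH]; first by case: j.
rewrite leq_eqVlt => /predU1P[->//|jk] kn.
by apply: le_trans (ltW (location_lt _)); [apply: IH; lia | lia].
Qed.

Lemma split_cost_travel_time (j : nat) :
  (j <= n)%N -> travel_times u (split_cost j).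
Proof.
move=> jn.
have b0 : 0 <= location j by apply: (@location_le 0); lia.
have a0 : 0 <= 1 - location j.+1.
  by rewrite subr_ge0 -location_last location_le.
have [r rT rP] := two_leg_route a0 b0.
exists r => //= i; have /andP[ui0 ui1] := hu.1 i.
have [ij|ji] := ltnP i j.
  exists (u i); last by rewrite subrr.
  apply: rP; have := @location_le i.+1 j ij (leqW jn).
  by rewrite locationS; lra.
(* The remaining items are met through their lift one turn below. *)
exists (u i - 1); last by rewrite addrC addKr rpredN rpred1.
apply: rP; have := @location_le j.+1 i.+1 ji (leqW (ltn_ord i)).
rewrite locationS; lra.
Qed.

Lemma split_cost_le_duration (r : route R) :
  collects u r -> exists j : 'I_n.+1, split_cost j <= duration r.
Proof.
move=> ru; have [lo [hi [/andP[lo0 hi0] rT rP]]] := route_hull r 0.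
(* [j] is the last location that the hull reaches on the positive side; index 0 qualifies since
   [0 <= hi]. *)
case: (@arg_maxnP _ (ord0 : 'I_n.+1) (fun j => location j <= hi) val) => //.
move=> j jhi jmax.
exists j; apply: le_trans rT.
have jlo : 1 - location j.+1 <= - lo.
  have [jn|nj] := ltnP j n; last first.
    have -> : nat_of_ord j = n by have := ltn_ord j; lia.
    rewrite location_last; lra.
  pose i := Ordinal jn.
  have hiu : hi < location i.+1.
    rewrite ltNge; apply/negP => h.
    by have := jmax (Ordinal (jn : (j.+1 < n.+1)%N)) h; rewrite /= ltnn.
  (* Item [i] sits at location [j.+1], beyond [hi], so it is met at a lift [u i + z] with [z < 0].
     As [z] is an integer, [z <= -1], which forces [lo <= u i - 1]. *)
  have [q /rP /andP[q1 q2] /intrP[z qz]] := ru i.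
  have : z%:~R < (0 : R) by rewrite -qz -locationS; lra.
  rewrite ltrz0 -lezD1 ?add0r => zN.
  have : z%:~R <= ((-1) : R) by rewrite (_ : -1 = (-1)%:~R) // ler_int; lia.
  rewrite -qz -locationS /=; lra.
rewrite /split_cost; case: (leP (1 - _)) => ?; case: (leP (0 - lo)) => ?; lra.
Qed.

Lemma minimal_travel_time_split (T : R) :
    (exists2 j, (j <= n)%N & T = split_cost j) ->
    (forall j, (j <= n)%N -> T <= split_cost j) ->
  minimal_travel_time u T.
Proof.
move=> [j jn ->] jmin; split; first exact: split_cost_travel_time.
move=> _ [r /split_cost_le_duration[k kr] <-].
by apply: le_trans kr; apply: jmin; rewrite -ltnS.
Qed.

End Locations.

Lemma alphaSE (R : realType) (n : nat) :
  alphaS R n = (2 ^+ n./2.+1 + 2 ^+ uphalf n - 2)^-1.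
Proof.
rewrite /alphaS uphalf_half; case: odd; rewrite div1r ?add0n //.
by rewrite add1n mulr_natl mulr2n.
Qed.

(** The quantity [v j + b] starts at [b] and at most doubles at each step. *)
Lemma doubling_bound (R : realType) (v : nat -> R) (b : R) (n : nat) :
    v 0%N = 0 -> (forall j, (j < n)%N -> v j.+1 <= 2 * v j + b) ->
  v n <= (2 ^+ n - 1) * b.
Proof.
move=> v0; elim: n => [|n IH] vS; first by rewrite v0 subrr mul0r.
have := IH (fun j jn => vS j (leqW jn)); have := vS n (ltnSn n).
rewrite exprS; nra.
Qed.

Lemma alphaS_le (R : realType) (n : nat) (u : 'I_n -> R) (T : R) :
    (forall j, (j <= n)%N -> T <= split_cost u j) ->
  T <= 1 - alphaS R n.
Proof.
move=> Tmin; pose b := 1 - T.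
have gap j : (j <= n)%N -> location u j.+1 - location u j <= b + location u j
    /\ location u j.+1 - location u j <= b + (1 - location u j.+1).
  move=> /Tmin; rewrite split_cost_gap /b; case: (leP (1 - _)) => ?; lra.
(* The two doubling chains meet at location [k]: [k] steps up from 0 and [n./2.+1] steps down from
   1. These are the two exponents in [alphaSE]. *)
pose k := uphalf n.
have nk : (n.+1 - k = n./2.+1)%N by rewrite /k; have := uphalf_half n; lia.
have low : location u k <= (2 ^+ k - 1) * b.
  apply: doubling_bound => // j jk.
  by have [] := gap j; [rewrite /k in jk; lia | lra].
have high : 1 - location u k <= (2 ^+ n./2.+1 - 1) * b.
  have := @doubling_bound R (fun i => 1 - location u (n.+1 - i)) b n./2.+1.
  rewrite -{2}nk subKn; last by rewrite /k; lia.
  apply; first by rewrite subn0 location_last subrr.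
  move=> j jn; have [|_] := gap (n.+1 - j.+1)%N; first by lia.
  by rewrite (_ : (n.+1 - j.+1).+1 = n.+1 - j)%N; [lra | lia].
rewrite alphaSE -/k; set s := _ + _ - 2.
have s0 : 0 < s.
  have : 1 <= 2 ^+ k :> R by rewrite exprn_ege1 // ler1n.
  have : 1 <= 2 ^+ n./2 :> R by rewrite exprn_ege1 // ler1n.
  by rewrite /s exprS; lra.
(* Adding [low] and [high] cancels [location u k] and leaves [1 <= s * b]. *)
have : s^-1 <= b.
  by rewrite -div1r ler_pdivrMr // /s mulrC; move: low high; lra.
by rewrite /b; lra.
Qed.

Section Extremal.
Variable n : nat.

(** Location [k] of the extremal configuration in units of [alphaS R n], kept in [nat] for exact
    arithmetic. *)
Definition extremal_sum (k : nat) : nat := \sum_(i < k) 2 ^ minn i (n - i).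

Lemma extremal_sumS (k : nat) :
  extremal_sum k.+1 = (extremal_sum k + 2 ^ minn k (n - k))%N.
Proof. by rewrite /extremal_sum big_ord_recr. Qed.

(** The exponent grows by at most one per step, so each gap is at most twice the previous one, while
    the sum gains that previous gap. *)
Lemma extremal_gap_le (k : nat) : (2 ^ minn k (n - k) <= (extremal_sum k).+1)%N.
Proof.
elim: k => [|k IH]; first by rewrite min0n expn0.
apply: (@leq_trans (2 ^ (minn k (n - k)).+1)).
  by rewrite leq_exp2l //; lia.
by rewrite extremal_sumS expnS; lia.
Qed.

(** The sequence of gaps is a palindrome. *)
Lemma extremal_sum_rev (k : nat) : (k <= n.+1)%N ->
  (extremal_sum k + extremal_sum (n.+1 - k) = extremal_sum n.+1)%N.
Proof.
elim: k => [|k IH] kn; first by rewrite /extremal_sum big_ord0 subn0.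
rewrite -(IH (ltnW kn)) subSS subSn // !extremal_sumS subKn // minnC; lia.
Qed.

End Extremal.

Lemma extremal_sum_total (n : nat) :
  (extremal_sum n n.+1 + 2 = 2 ^ n./2.+1 + 2 ^ uphalf n)%N.
Proof.
suff [//] : (extremal_sum n n.+1 + 2 = 2 ^ n./2.+1 + 2 ^ uphalf n)%N
   /\ (extremal_sum n.+1 n.+2 + 2 = 2 ^ n.+1./2.+1 + 2 ^ uphalf n.+1)%N.
(* Induction in steps of two: passing from [n] to [n.+2] doubles every gap and adds a gap 1 at each
   end. *)
elim: n => [|n [IH1 IH2]].
  by rewrite /extremal_sum !big_ord_recr !big_ord0.
split=> //; rewrite /extremal_sum big_ord_recl big_ord_recr /=.
rewrite (eq_bigr (fun i : 'I_n.+1 => 2 * 2 ^ minn i (n - i)))%N; last first.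
  move=> i _; rewrite /bump /= -expnS; congr (_ ^ _)%N.
  by have := ltn_ord i; lia.
rewrite -big_distrr /= -/(extremal_sum n n.+1) min0n subnn minn0.
by move: IH1; rewrite /= !expnS; lia.
Qed.

Theorem lemma2p1 (R : realType) (n : nat) (hn : (1 <= n)%N) :
  (forall u : 'I_n -> R, item_locations u ->
     exists2 T : R, minimal_travel_time u T & T <= 1 - alphaS R n) /\
  (exists2 u : 'I_n -> R,
     item_locations u & minimal_travel_time u (1 - alphaS R n)).
Proof.
split=> [u hu|].
  case: (@Order.TotalTheory.arg_minP _ _ _ (ord0 : 'I_n.+1) xpredT
           (fun j => split_cost u j)) => // j _ jmin.
  have jmin' k : (k <= n)%N -> split_cost u j <= split_cost u k.
    by move=> kn; apply: (jmin (Ordinal (kn : (k < n.+1)%N))).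
  exists (split_cost u j); last exact: alphaS_le jmin'.
  by apply: minimal_travel_time_split => //; exists j; rewrite // -ltnS.
(* By [extremal_sum_total], scaling by [a] makes the whole circle have length 1. *)
pose a := alphaS R n; pose S k := (extremal_sum n k)%:R : R.
have aS : a * S n.+1 = 1.
  have E : S n.+1 = 2 ^+ n./2.+1 + 2 ^+ uphalf n - 2.
    by rewrite -!natrX -natrD -extremal_sum_total natrD addrK.
  rewrite /a alphaSE -E mulVf // pnatr_eq0 extremal_sumS.
  by have := expn_gt0 2 (minn n (n - n)); lia.
have S0 : S 0%N = 0 by rewrite /S /extremal_sum big_ord0.
have Slt : {homo S : i j / (i < j)%N >-> i < j}.
  apply: homo_ltn; first exact: lt_trans.
  by move=> i; rewrite ltr_nat extremal_sumS -addn1 leq_add2l expn_gt0.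
have Spos : 0 < S n.+1 by rewrite -S0 Slt.
have a0 : 0 < a by rewrite -(pmulr_lgt0 _ Spos) aS.
pose u (i : 'I_n) := a * S i.+1.
have uE k : (k <= n.+1)%N -> location u k = a * S k.
  case: k => [|k]; first by rewrite S0 mulr0.
  rewrite leq_eqVlt => /predU1P[[->]|kn]; first by rewrite location_last aS.
  by rewrite (locationS u (Ordinal (kn : (k < n)%N))).
have hu : item_locations u.
  split=> [i|i j ij]; last by rewrite ltr_pM2l // Slt.
  rewrite pmulr_rgt0 // -{1}S0 Slt //= -aS ltr_pM2l // Slt //.
  by rewrite ltnS.
exists u => //; apply: minimal_travel_time_split => //.
  (* The purely clockwise route attains the value: the first gap is [a] and the doubled arm is 0. *)
  exists 0%N => //; rewrite split_cost_gap !uE // S0 mulr0 -/a.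
  have -> : S 1%N = 1 by rewrite /S extremal_sumS min0n /extremal_sum big_ord0.
  have : a * 1 <= a * S n.+1.
    rewrite ler_pM2l // ler1n extremal_sumS.
    by have := expn_gt0 2 (minn n (n - n)); lia.
  by rewrite aS; case: (leP (1 - _)) => ?; lra.
move=> j jn; rewrite split_cost_gap !uE -/a; [|lia|lia].
have SS : S j.+1 = S j + (2 ^ minn j (n - j))%:R.
  by rewrite /S extremal_sumS natrD.
(* [low] and [high] say that gap [j] exceeds neither of the two arms beside it by more than one
   unit, so no split costs less than [1 - a]. *)
have low : (2 ^ minn j (n - j))%:R <= S j + 1.
  by rewrite /S natr1 ler_nat extremal_gap_le.
have high : (2 ^ minn j (n - j))%:R <= S (n - j)%N + 1.
  rewrite /S natr1 ler_nat.
  by have := extremal_gap_le n (n - j); rewrite subKn // minnC.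
have rev : S n.+1 = S j.+1 + S (n - j)%N.
  by rewrite /S -natrD -(@extremal_sum_rev n j.+1) ?subSS.
have Eg : a * S j.+1 - a * S j = a * (2 ^ minn j (n - j))%:R.
  by rewrite SS; ring.
have Ew : 1 - a * S j.+1 = a * S (n - j)%N by rewrite -aS rev; ring.
rewrite -(ler_pM2l a0) in low; rewrite -(ler_pM2l a0) in high.
move: low high; rewrite !mulrDr mulr1 -Eg -Ew.
by case: (leP (1 - a * _)) => ?; lra.
Qed.
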